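(* Let $p\in(0,1]$. For every $p$-Banach space $E$, the free $p$-Banach lattice over $E$ exists. That is, there exist a $p$-Banach lattice $\mathrm{FpBL}[E]$ and a linear isometric embedding $\delta:E\to \mathrm{FpBL}[E]$ such that for every $p$-Banach lattice $X$ and every operator $T:E\to X$ there is a unique lattice homomorphism $\widehat T:\mathrm{FpBL}[E]\to X$ with $\widehat T\delta=T$, and moreover $\|\widehat T\|=\|T\|$.
   Context: All spaces are real. For $p\in(0,1]$, a $p$-norm on a vector space $E$ is a map $\|\cdot\|:E\to[0,\infty)$ with $\|e\|=0\Rightarrow e=0$, $\|\lambda e\|=|\lambda|\|e\|$ and $\|e+e'\|^p\le\|e\|^p+\|e'\|^p$. A $p$-Banach space is a space complete for the linear topology induced by its $p$-norm. A $p$-Banach lattice is a $p$-Banach space which is also a vector lattice and such that $|x|\le|y|$ implies $\|x\|\le\|y\|$. ''Operator'' means continuous linear map; lattice homomorphisms between $p$-Banach lattices are linear, continuous, and preserve finite suprema and infima; $\|T\|=\sup_{\|e\|\le1}\|Te\|$. *)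

(* Defs.v *)
From HB Require Import structures.
From mathcomp Require Import all_boot all_order all_algebra.
From mathcomp Require Import all_classical all_reals all_analysis.

Set Implicit Arguments.
Unset Strict Implicit.
Unset Printing Implicit Defensive.

Import Order.TTheory GRing.Theory Num.Theory.

Local Open Scope classical_set_scope.
Local Open Scope ring_scope.

(* The uniformity is the one of the linear topology induced by [pnorm]. It is
   not expressed with [pseudoMetricType], because for [p < 1] the balls of
   [pnorm] do not satisfy the triangle axiom of that structure. *)
HB.mixin Record isPNormed (R : realType) (p : R) E
    of PreUniformLmodule R E := {
  pnorm : E -> R ;
  pnorm_ge0 : forall x, 0 <= pnorm x ;
  pnorm0_eq0 : forall x, pnorm x = 0 -> x = 0 ;
  pnormZ : forall (a : R) x, pnorm (a *: x) = `|a| * pnorm x ;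
  ler_pnormD : forall x y,
    pnorm (x + y) `^ p <= pnorm x `^ p + pnorm y `^ p ;
  entourage_pnormE : (entourage : set_system (E * E)) = entourage_ (ball_ pnorm)
}.

#[short(type="pnormedType")]
HB.structure Definition PNormed (R : realType) (p : R) :=
  {E of PreUniformLmodule R E & isPNormed R p E}.

(* The field is that of [Uniform_isComplete], without the choice of a default
   point that [cvg] requires. The structure [Complete] itself
   cannot be joined here: in the hierarchy its only join with [Lmodule] is
   [CompleteNormedModule]. *)
HB.mixin Record PNormed_isPBanach (R : realType) (p : R) E of PNormed R p E := {
  pbanach_cauchy_cvg : forall F : set_system E,
    ProperFilter F -> cauchy F -> exists x : E, F --> x
}.

#[short(type="pbanachType")]
HB.structure Definition PBanach (R : realType) (p : R) :=
  {E of PNormed R p E & PNormed_isPBanach R p E}.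

(* The lattice operations are characterized as in [latticeType], which cannot be
   joined here for the same kind of reason: [Num.RealDomain] is already its
   join with [Zmodule]. *)
HB.mixin Record isVectorLattice (R : realType) X
    of Num.POrderedZmodule X & GRing.Lmodule R X := {
  vlat_leD2r : forall z x y : X, x <= y -> x + z <= y + z ;
  vlat_leZ2l : forall (a : R) (x y : X), 0 <= a -> x <= y -> a *: x <= a *: y ;
  vmeet : X -> X -> X ;
  vjoin : X -> X -> X ;
  vlat_lexI : forall x y z : X, (z <= vmeet x y) = (z <= x) && (z <= y) ;
  vlat_leUx : forall x y z : X, (vjoin x y <= z) = (x <= z) && (y <= z)
}.

#[short(type="vectorLatticeType")]
HB.structure Definition VectorLattice (R : realType) :=
  {X of Num.POrderedZmodule X & GRing.Lmodule R X & isVectorLattice R X}.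

Definition vabs (R : realType) (X : vectorLatticeType R) (x : X) : X :=
  vjoin x (- x).

HB.mixin Record isPBanachLattice (R : realType) (p : R) X
    of PBanach R p X & VectorLattice R X := {
  ler_pnorm_vabs : forall x y : X, vabs x <= vabs y -> pnorm x <= pnorm y
}.

#[short(type="pbanachLatticeType")]
HB.structure Definition PBanachLattice (R : realType) (p : R) :=
  {X of PBanach R p X & VectorLattice R X & isPBanachLattice R p X}.

(* A real-valued supremum: it is meaningful because [T] is applied to continuous
   linear maps only, whose values on the unit ball are bounded. *)
Definition opnorm (R : realType) (p : R) (E F : pnormedType p) (T : E -> F) : R :=
  sup [set pnorm (T e) | e in [set e : E | pnorm e <= 1]].

Definition lattice_homomorphism (R : realType) (p : R)
    (X Y : pbanachLatticeType p) (f : {linear X -> Y}) : Prop :=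
  [/\ continuous f, {morph f : x y / vmeet x y >-> vmeet x y}
    & {morph f : x y / vjoin x y >-> vjoin x y}].

(* Main.v *)
Require Import Defs.
From HB Require Import structures.
From mathcomp Require Import all_boot all_order all_algebra.
From mathcomp Require Import all_classical all_reals all_analysis.

Set Implicit Arguments.
Unset Strict Implicit.
Unset Printing Implicit Defensive.

Import Order.TTheory GRing.Theory Num.Theory.
Import numFieldNormedType.Exports.
Local Open Scope classical_set_scope.
Local Open Scope ring_scope.

(** The free object is the completion of the free vector lattice over [E] for
    the largest lattice [p]-seminorm that is at most the norm of [E] on
    generators. The free vector lattice consists of the lattice-linear
    expressions in elements of [E], identified when they agree under all linear
    maps from [E] to vector lattices; it carries the gauge

      [inf { sum ||e_i||^p : |f| <= sum |e_i| }]        ([free_gauge])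

    which is the [p]-th power of that [p]-seminorm; the inequality is that of
    the free vector lattice.

    If [T] is an operator from [E] to a [p]-Banach lattice [X], then
    [|f| <= sum |e_i|] is mapped to [|Tf| <= sum |T e_i|], hence
    [||Tf||^p <= sum ||T e_i||^p <= ||T||^p sum ||e_i||^p] ([feval_bound]). So
    the homomorphism induced on the free vector lattice is bounded by [||T||]
    and extends to the completion ([completion_extension]). Uniqueness holds
    because the generators determine a homomorphism on the free vector lattice,
    which is dense.

    The substance is that the generators keep their norm ([free_gauge_gen]),
    that is, that [|x| <= sum |x_i|] implies [||x||^p <= sum ||x_i||^p]. For
    [p < 1] the continuous dual of [E] may vanish, but the order on the free
    vector lattice refers to all linear functionals, continuous or not: the
    inequality gives [|phi x| <= sum |phi x_i|] for every [phi] in the algebraic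
    dual. By a Hahn-Banach argument ([pnorm_le_domination]) this makes [x] a
    combination of the [x_i] with coefficients of absolute value at most 1, and
    the [p]-triangle inequality concludes. *)

(** * Vector lattices *)

Section VectorLatticeTheory.
Variables (R : realType) (X : vectorLatticeType R).
Implicit Types x y z t : X.

Lemma le_vjoinl x y : x <= vjoin x y.
Proof. by have := vlat_leUx x y (vjoin x y); rewrite lexx => /esym/andP[]. Qed.

Lemma le_vjoinr x y : y <= vjoin x y.
Proof. by have := vlat_leUx x y (vjoin x y); rewrite lexx => /esym/andP[]. Qed.

Lemma vjoin_le x y z : x <= z -> y <= z -> vjoin x y <= z.
Proof. by move=> xz yz; rewrite vlat_leUx xz yz. Qed.

Lemma vjoinC x y : vjoin x y = vjoin y x.
Proof. by apply/le_anti; rewrite !vlat_leUx !le_vjoinl !le_vjoinr. Qed.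

Lemma vjoinA x y z : vjoin x (vjoin y z) = vjoin (vjoin x y) z.
Proof.
apply/le_anti/andP; split; do ?[apply: vjoin_le].
- exact: le_trans (le_vjoinl x y) (le_vjoinl _ _).
- exact: le_trans (le_vjoinr x y) (le_vjoinl _ _).
- exact: le_vjoinr.
- exact: le_vjoinl.
- exact: le_trans (le_vjoinl y z) (le_vjoinr _ _).
- exact: le_trans (le_vjoinr y z) (le_vjoinr _ _).
Qed.

Lemma vjoinxx x : vjoin x x = x.
Proof. by apply/le_anti; rewrite vlat_leUx lexx le_vjoinl. Qed.

Lemma vjoin_idPl x y : reflect (vjoin x y = y) (x <= y).
Proof.
apply: (iffP idP) => [xy|<-]; last exact: le_vjoinl.
by apply/le_anti; rewrite vlat_leUx xy lexx le_vjoinr.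
Qed.

Lemma vleD2r z x y : (x + z <= y + z) = (x <= y).
Proof.
by apply/idP/idP => [/(vlat_leD2r (- z))|/vlat_leD2r//]; rewrite !addrK.
Qed.

Lemma vleD x y z t : x <= y -> z <= t -> x + z <= y + t.
Proof.
move=> xy zt; apply: (@le_trans _ _ (y + z)); first by rewrite vleD2r.
by rewrite ![y + _]addrC vleD2r.
Qed.

Lemma vleBlDr x y z : (x - y <= z) = (x <= z + y).
Proof. by rewrite -[LHS](vleD2r y) subrK. Qed.

Lemma vleN2 x y : (- x <= - y) = (y <= x).
Proof. by rewrite -[LHS](vleD2r (x + y)) addKr addrC addrK. Qed.

Lemma vjoinDr x y z : vjoin x y + z = vjoin (x + z) (y + z).
Proof.
apply/le_anti; apply/andP; split; last first.
  by apply: vjoin_le; rewrite vleD2r ?le_vjoinl ?le_vjoinr.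
rewrite -[z in leLHS]opprK vleBlDr.
by apply: vjoin_le; rewrite -vleBlDr opprK ?le_vjoinl ?le_vjoinr.
Qed.

Lemma vjoinZ (a : R) x y : 0 <= a -> a *: vjoin x y = vjoin (a *: x) (a *: y).
Proof.
rewrite le0r => /orP[/eqP ->|a0]; first by rewrite !scale0r vjoinxx.
have a0' := ltW a0; have aN0 : a != 0 by rewrite gt_eqF.
apply/le_anti; apply/andP; split; last first.
  by apply: vjoin_le; apply: vlat_leZ2l; rewrite ?le_vjoinl ?le_vjoinr.
have K z : z = a *: (a^-1 *: z) by rewrite scalerA divff ?scale1r.
rewrite [leRHS]K; apply: vlat_leZ2l => //; apply: vjoin_le.
  rewrite -[x in leLHS](scale1r) -[X in X *: _](@mulVf _ a)// -scalerA.
  by apply: vlat_leZ2l; rewrite ?invr_ge0 ?le_vjoinl.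
rewrite -[y in leLHS](scale1r) -[X in X *: _](@mulVf _ a)// -scalerA.
by apply: vlat_leZ2l; rewrite ?invr_ge0 ?le_vjoinr.
Qed.

(** Negation reverses the order, so meets are governed by joins: below, a map
    that is linear and preserves joins is a lattice homomorphism. *)
Lemma vmeetE x y : vmeet x y = - vjoin (- x) (- y).
Proof.
apply/le_anti; apply/andP; split.
  rewrite -[leLHS]opprK vleN2; apply: vjoin_le; rewrite vleN2.
    by have := vlat_lexI x y (vmeet x y); rewrite lexx => /esym/andP[].
  by have := vlat_lexI x y (vmeet x y); rewrite lexx => /esym/andP[].
rewrite vlat_lexI; apply/andP; split; rewrite -[leRHS]opprK vleN2.
  exact: le_vjoinl.
exact: le_vjoinr.
Qed.

Lemma le_vabs x : x <= vabs x.
Proof. exact: le_vjoinl. Qed.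

Lemma lerN_vabs x : - x <= vabs x.
Proof. exact: le_vjoinr. Qed.

Lemma vabs_le x y : x <= y -> - x <= y -> vabs x <= y.
Proof. exact: vjoin_le. Qed.

Lemma vabsN x : vabs (- x) = vabs x.
Proof. by rewrite /vabs opprK vjoinC. Qed.

Lemma vabs_ge0 x : 0 <= vabs x.
Proof.
have h : 0 <= vabs x + vabs x.
  by rewrite -(subrr x); apply: vleD; rewrite ?le_vabs ?lerN_vabs.
have hh : vabs x = 2^-1 *: (vabs x + vabs x).
  rewrite -mulr2n -[vabs x *+ 2]scaler_nat.
  by rewrite scalerA mulVf ?pnatr_eq0// scale1r.
by rewrite hh -(scaler0 _ 2^-1) vlat_leZ2l// invr_ge0.
Qed.

Lemma vabs_id x : 0 <= x -> vabs x = x.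
Proof.
move=> x0; apply/le_anti; rewrite le_vabs andbT; apply: vabs_le => //.
by apply: (@le_trans _ _ 0) => //; rewrite -oppr0 vleN2.
Qed.

Lemma vabs0 : vabs (0 : X) = 0.
Proof. exact: vabs_id. Qed.

Lemma vabs_vabs x : vabs (vabs x) = vabs x.
Proof. exact/vabs_id/vabs_ge0. Qed.

Lemma vabsD x y : vabs (x + y) <= vabs x + vabs y.
Proof.
by apply: vabs_le; rewrite ?opprD; apply: vleD; rewrite ?le_vabs ?lerN_vabs.
Qed.

Lemma vabsZ (a : R) x : vabs (a *: x) = `|a| *: vabs x.
Proof.
have [a0|a0] := leP 0 a.
  by rewrite ger0_norm// /vabs vjoinZ// scalerN.
rewrite ltr0_norm// /vabs vjoinZ ?oppr_ge0 ?ltW//.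
by rewrite scalerN !scaleNr opprK vjoinC.
Qed.

Lemma vabs_sum (I : Type) (s : seq I) (f : I -> X) :
  vabs (\sum_(i <- s) f i) <= \sum_(i <- s) vabs (f i).
Proof.
elim: s => [|i s IH]; first by rewrite !big_nil vabs0.
by rewrite !big_cons; apply: le_trans (vabsD _ _) _; apply: vleD.
Qed.

Lemma vsum_abs_ge0 (I : Type) (s : seq I) (f : I -> X) :
  0 <= \sum_(i <- s) vabs (f i).
Proof. by apply: le_trans (vabs_ge0 (\sum_(i <- s) f i)) (vabs_sum _ _). Qed.

Lemma vjoin_subr x y x' y' :
  vjoin x y - vjoin x' y' <= vabs (x - x') + vabs (y - y').
Proof.
rewrite vleBlDr; apply: vjoin_le.
  rewrite -[leLHS](subrK x'); apply: vleD; last exact: le_vjoinl.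
  by rewrite -[leLHS]addr0; apply: vleD; rewrite ?le_vabs ?vabs_ge0.
rewrite -[leLHS](subrK y'); apply: vleD; last exact: le_vjoinr.
by rewrite -[leLHS]add0r; apply: vleD; rewrite ?le_vabs ?vabs_ge0.
Qed.

(** The inequality that makes the lattice operations uniformly continuous for
    every lattice norm, hence lets them pass to completions and to limits. *)
Lemma vabs_vjoin_sub x y x' y' :
  vabs (vjoin x y - vjoin x' y') <= vabs (x - x') + vabs (y - y').
Proof.
apply: vabs_le; first exact: vjoin_subr.
rewrite opprB -[vabs (x - x')]vabsN -[vabs (y - y')]vabsN !opprB.
exact: vjoin_subr.
Qed.

End VectorLatticeTheory.

(** For a lattice order compatible with the linear structure, the axioms amount
    to equations in the join, the order being [x <= y] iff [join x y = y].
    Equations pass to quotients and limits; the two vector lattices constructed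
    below are obtained in this way. *)
HB.factory Record Lmodule_isVectorLattice (R : realType) X
    of GRing.Lmodule R X := {
  join : X -> X -> X ;
  joinC : forall x y, join x y = join y x ;
  joinA : forall x y z, join x (join y z) = join (join x y) z ;
  joinxx : forall x, join x x = x ;
  joinDr : forall x y z, join x y + z = join (x + z) (y + z) ;
  joinZ : forall (a : R) x y, 0 <= a -> a *: join x y = join (a *: x) (a *: y)
}.

HB.builders Context R X of Lmodule_isVectorLattice R X.

Definition le_join (x y : X) := join x y == y.

Fact le_join_refl : reflexive le_join.
Proof. by move=> x; rewrite /le_join joinxx. Qed.

Fact le_join_anti : antisymmetric le_join.
Proof. by move=> x y /andP[/eqP xy /eqP]; rewrite joinC xy. Qed.

Fact le_join_trans : transitive le_join.
Proof. by move=> y x z /eqP xy /eqP <-; rewrite /le_join joinA xy. Qed.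

HB.instance Definition _ := Order.Le_isPOrder.Build ring_display X
  le_join_refl le_join_anti le_join_trans.

Fact le_joinD (z x y : X) : x <= y -> x + z <= y + z.
Proof. by move=> /eqP xy; apply/eqP; rewrite -joinDr xy. Qed.

Fact le_joinZ (a : R) (x y : X) : 0 <= a -> x <= y -> a *: x <= a *: y.
Proof. by move=> a0 /eqP xy; apply/eqP; rewrite -joinZ// xy. Qed.

Fact join_le (x y z : X) : (join x y <= z) = (x <= z) && (y <= z).
Proof.
apply/eqP/andP => [xyz|[/eqP xz /eqP yz]]; last by rewrite -joinA yz.
split; apply/eqP; rewrite -xyz.
  by rewrite !joinA joinxx.
by rewrite [join x y]joinC !joinA joinxx.
Qed.

Fact le_joinN (x y : X) : (x <= - y) = (y <= - x).
Proof.
have imp (u v : X) : u <= - v -> v <= - u.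
  by move=> /(le_joinD (v - u)); rewrite addrC subrK addKr.
by apply/idP/idP; exact: imp.
Qed.

Fact le_meet (x y z : X) :
  (z <= - join (- x) (- y)) = (z <= x) && (z <= y).
Proof.
by rewrite le_joinN join_le -le_joinN opprK -[in X in _ && X]le_joinN opprK.
Qed.

HB.instance Definition _ := isVectorLattice.Build R X
  le_joinD le_joinZ le_meet join_le.

HB.end.

(** * Lattice gauges *)

Section PowerR.
Variables (R : realType) (p : R).
Hypothesis hp : 0 < p.

Lemma powRVK (a : R) : 0 <= a -> (a `^ p^-1) `^ p = a.
Proof. by move=> a0; rewrite -powRrM mulVf ?gt_eqF// powRr1. Qed.

Lemma powRKV (a : R) : 0 <= a -> (a `^ p) `^ p^-1 = a.
Proof. by move=> a0; rewrite -powRrM mulfV ?gt_eqF// powRr1. Qed.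

Lemma ler_powRr (a b : R) : 0 <= a -> 0 <= b -> (a `^ p <= b `^ p) = (a <= b).
Proof.
move=> a0 b0; have [ab|ba] := leP a b.
  by rewrite (ge0_ler_powR (ltW hp)).
by apply/negbTE; rewrite -ltNge (gt0_ltr_powR hp).
Qed.

Lemma ltr_powRr (a b : R) : 0 <= a -> 0 <= b -> (a `^ p < b `^ p) = (a < b).
Proof. by move=> a0 b0; rewrite !ltNge ler_powRr. Qed.

End PowerR.

(** The [p]-th power of a lattice [p]-seminorm. It is subadditive even when the
    seminorm is not, so that it yields a translation-invariant pseudometric. *)
Record lattice_gauge (R : realType) (p : R) (X : vectorLatticeType R)
    (Q : X -> R) : Prop := LatticeGauge {
  gaugeD : forall x y, Q (x + y) <= Q x + Q y ;
  gaugeZ : forall a x, Q (a *: x) = `|a| `^ p * Q x ;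
  gauge_le : forall x y, vabs x <= vabs y -> Q x <= Q y
}.

Definition null (R : realType) (X : Type) (Q : X -> R) (u : nat -> X) : Prop :=
  Q (u n) @[n --> \oo] --> (0 : R).

Definition vanishing (R : realType) (d : nat -> nat -> R) : Prop :=
  forall e, 0 < e ->
    exists N, forall m n, (N <= m)%N -> (N <= n)%N -> d m n < e.

Lemma le_vanishing (R : realType) (d d' : nat -> nat -> R) :
  (forall m n, d m n <= d' m n) -> vanishing d' -> vanishing d.
Proof.
move=> dd' h e /h[N hN]; exists N => m n Nm Nn.
by apply: le_lt_trans (dd' m n) _; exact: hN.
Qed.

Lemma vanishingD (R : realType) (d d' : nat -> nat -> R) :
  vanishing d -> vanishing d' -> vanishing (fun m n => d m n + d' m n).
Proof.
move=> h h' e e0; have e2 : 0 < e / 2 by rewrite divr_gt0.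
have [N hN] := h _ e2; have [N' hN'] := h' _ e2.
exists (maxn N N') => m n; rewrite !geq_max => /andP[Nm N'm] /andP[Nn N'n].
by rewrite [e]splitr ltrD ?hN ?hN'.
Qed.

Lemma vanishingZ (R : realType) (k : R) (d : nat -> nat -> R) : 0 <= k ->
  vanishing d -> vanishing (fun m n => k * d m n).
Proof.
move=> k0 h e e0; have k1 : 0 < k + 1 by rewrite ltr_wpDl.
have [N hN] := h (e / (k + 1)) (divr_gt0 e0 k1); exists N => m n Nm Nn.
have [d0|d0] := leP (d m n) 0.
  by apply: le_lt_trans e0; rewrite mulr_ge0_le0.
apply: (@lt_trans _ _ ((k + 1) * d m n)); first by rewrite ltr_pM2r// ltrDl.
by rewrite mulrC -ltr_pdivlMr// hN.
Qed.

Lemma vanishing0 (R : realType) : vanishing (fun _ _ => 0 : R).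
Proof. by move=> e e0; exists 0%N. Qed.

Section Gauge.
Variables (R : realType) (p : R).
Hypothesis hp : 0 < p.
Variables (X : vectorLatticeType R) (Q : X -> R).
Hypothesis hQ : lattice_gauge p Q.

Lemma gauge0 : Q 0 = 0.
Proof. by rewrite -(scale0r 0) (gaugeZ hQ) normr0 powR0 ?gt_eqF// mul0r. Qed.

Lemma gauge_ge0 x : 0 <= Q x.
Proof. by rewrite -gauge0; apply: (gauge_le hQ); rewrite vabs0 vabs_ge0. Qed.

Lemma gaugeN x : Q (- x) = Q x.
Proof. by rewrite -scaleN1r (gaugeZ hQ) normrN normr1 powR1 mul1r. Qed.

Lemma gaugeC x y : Q (x - y) = Q (y - x).
Proof. by rewrite -gaugeN opprB. Qed.

Lemma gauge_tri y x z : Q (x - z) <= Q (x - y) + Q (y - z).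
Proof. by have := gaugeD hQ (x - y) (y - z); rewrite addrA subrK. Qed.

Lemma gauge_abs x : Q (vabs x) = Q x.
Proof. by apply/le_anti; rewrite !(gauge_le hQ) ?vabs_vabs. Qed.

Lemma gauge_dist x y : `|Q x - Q y| <= Q (x - y).
Proof.
rewrite ler_norml lerBlDr lerNl opprB lerBlDr; apply/andP; split.
  by have := gaugeD hQ (y - x) x; rewrite subrK gaugeC.
by have := gaugeD hQ (x - y) y; rewrite subrK.
Qed.

Lemma gauge_sum (I : Type) (s : seq I) (f : I -> X) :
  Q (\sum_(i <- s) f i) <= \sum_(i <- s) Q (f i).
Proof.
elim: s => [|i s IH]; first by rewrite !big_nil gauge0.
by rewrite !big_cons; apply: le_trans (gaugeD hQ _ _) _; rewrite lerD2l.
Qed.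

Lemma gauge_vjoin x y x' y' :
  Q (vjoin x y - vjoin x' y') <= Q (x - x') + Q (y - y').
Proof.
rewrite -[Q (x - x')]gauge_abs -[Q (y - y')]gauge_abs.
apply: le_trans (gaugeD hQ _ _); apply: (gauge_le hQ).
rewrite [leRHS]vabs_id ?vabs_vjoin_sub//.
by rewrite -[0]addr0; apply: vleD; exact: vabs_ge0.
Qed.

Lemma null_le (u : nat -> X) (v : nat -> R) : (forall n, Q (u n) <= v n) ->
  v n @[n --> \oo] --> (0 : R) -> null Q u.
Proof.
move=> uv v0; apply: (squeeze_cvgr _ (cvg_cst 0) v0).
by near=> n; rewrite gauge_ge0 uv.
Unshelve. all: by end_near. Qed.

Lemma null0 : null Q (fun=> 0).
Proof.
by apply: (null_le (v := fun=> 0)) => [n|]; rewrite ?gauge0//; exact: cvg_cst.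
Qed.

Lemma nullD (u v : nat -> X) : null Q u -> null Q v ->
  null Q (fun n => u n + v n).
Proof.
move=> u0 v0; apply: (null_le (v := fun n => Q (u n) + Q (v n))).
  by move=> n; exact: (gaugeD hQ).
by rewrite -[X in _ --> X]addr0; exact: cvgD.
Qed.

Lemma nullZ (a : R) (u : nat -> X) : null Q u -> null Q (fun n => a *: u n).
Proof.
move=> u0; apply: (null_le (v := fun n => `|a| `^ p * Q (u n))).
  by move=> n; rewrite (gaugeZ hQ).
by rewrite -[X in _ --> X](mulr0 (`|a| `^ p)); exact: cvgMl_tmp.
Qed.

Lemma null_sub_sym (u v : nat -> X) :
  null Q (fun n => u n - v n) -> null Q (fun n => v n - u n).
Proof. by apply: null_le => n; rewrite gaugeC. Qed.

Lemma null_sub_trans (v u w : nat -> X) : null Q (fun n => u n - v n) ->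
  null Q (fun n => v n - w n) -> null Q (fun n => u n - w n).
Proof.
move=> uv vw; have := nullD uv vw.
by apply: null_le => n; rewrite addrA subrK.
Qed.

Lemma null_vjoin (u u' v v' : nat -> X) : null Q (fun n => u n - u' n) ->
  null Q (fun n => v n - v' n) ->
  null Q (fun n => vjoin (u n) (v n) - vjoin (u' n) (v' n)).
Proof.
move=> u0 v0; apply: null_le (fun n => gauge_vjoin _ _ _ _) _.
by rewrite -[X in _ --> X]addr0; exact: cvgD.
Qed.

Lemma null_cst (x : X) : null Q (fun=> x) -> Q x = 0.
Proof. by move=> /cvg_lim <-//; rewrite lim_cst. Qed.

End Gauge.

(** * Topology of p-normed spaces and bounded operators *)

Section PNormedTopology.
Variables (R : realType) (p : R).
Hypothesis hp : 0 < p.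
Variable E : pnormedType p.

Lemma pnorm0 : pnorm (0 : E) = 0.
Proof. by rewrite -(scale0r 0) pnormZ normr0 mul0r. Qed.

Lemma pnormN (x : E) : pnorm (- x) = pnorm x.
Proof. by rewrite -scaleN1r pnormZ normrN normr1 mul1r. Qed.

Lemma pnormB (x y : E) : pnorm (x - y) = pnorm (y - x).
Proof. by rewrite -pnormN opprB. Qed.

Lemma pnorm_pow_lt (x : E) (e : R) : 0 < e ->
  (pnorm x `^ p < e) = (pnorm x < e `^ p^-1).
Proof.
move=> e0; rewrite -[RHS](ltr_powRr hp) ?pnorm_ge0 ?powR_ge0//.
by rewrite powRVK// ltW.
Qed.

Lemma nbhs_pnormP (x : E) (A : set E) :
  nbhs x A <-> exists2 e, 0 < e & forall y, pnorm (x - y) `^ p < e -> A y.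
Proof.
split.
  move=> /nbhsP[B]; rewrite entourage_pnormE => -[e e0 eB] BA.
  exists (e `^ p); first exact: powR_gt0.
  move=> y; rewrite pnorm_pow_lt ?powR_gt0// powRKV ?ltW// => xy.
  by apply: BA; apply/mem_set/eB.
move=> [e e0 eA]; apply/nbhsP; rewrite /= entourage_pnormE.
exists [set xy | pnorm (xy.1 - xy.2) < e `^ p^-1].
  by exists (e `^ p^-1) => //; exact: powR_gt0.
by move=> y /set_mem/=; rewrite -pnorm_pow_lt//; exact: eA.
Qed.

Lemma cvg_pnormP (F : set_system E) (x : E) : Filter F ->
  (forall e, 0 < e -> F [set y | pnorm (x - y) `^ p < e]) -> F --> x.
Proof.
move=> FF h A /nbhs_pnormP[e e0 eA].
by apply: filterS (h _ e0) => y; exact: eA.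
Qed.

Lemma cauchy_pnorm (F : set_system E) : ProperFilter F -> cauchy F ->
  forall e, 0 < e -> exists x, F [set y | pnorm (x - y) `^ p < e].
Proof.
move=> FF Fc e e0.
have [] := Fc [set xy | pnorm (xy.1 - xy.2) `^ p < e].
  rewrite entourage_pnormE; exists (e `^ p^-1); first exact: powR_gt0.
  by move=> xy /=; rewrite pnorm_pow_lt.
move=> [A B] /= [FA FB] AB; have [x Ax] := filter_ex FA.
by exists x; apply: filterS FB => y By; exact: (AB (x, y)).
Qed.

Lemma cauchy_pnorm_seq (u : nat -> E) :
  vanishing (fun m n => pnorm (u m - u n) `^ p) -> cauchy (u @ \oo).
Proof.
move=> h A; rewrite entourage_pnormE => -[e e0 eA].
have [N hN] := h _ (powR_gt0 p e0).
exists (u @` [set n | (N <= n)%N], u @` [set n | (N <= n)%N]).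
  by split=> /=; exists N => // n /= Nn; exists n.
move=> [x y] [/= [m Nm <-] [n Nn <-]]; apply: eA => /=.
by have := hN _ _ Nm Nn; rewrite pnorm_pow_lt ?powR_gt0// powRKV// ltW.
Qed.

End PNormedTopology.

Section BoundedOperators.
Variables (R : realType) (p : R).
Hypothesis hp : 0 < p.
Variables E F : pnormedType p.

Lemma continuous_pbounded (T : {linear E -> F}) : continuous T ->
  exists2 k, 0 <= k & forall x, pnorm (T x) <= k * pnorm x.
Proof.
move=> /(_ (0 : E)) T0.
have /(nbhs_pnormP hp)[d d0 hd] : nbhs (0 : E) (T @^-1` [set y | pnorm y < 1]).
  apply: T0; rewrite linear0; apply/(nbhs_pnormP hp); exists 1 => // y.
  by rewrite (pnorm_pow_lt hp)// powR1 sub0r pnormN.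
pose c := d `^ p^-1 / 2.
have c0 : 0 < c by rewrite divr_gt0// powR_gt0.
exists c^-1; first by rewrite invr_ge0 ltW.
move=> x; have [x0|x0] := eqVneq (pnorm x) 0.
  by rewrite (pnorm0_eq0 _ x0) linear0 !pnorm0 mulr0.
have xgt0 : 0 < pnorm x by rewrite lt_def x0 pnorm_ge0.
have cx0 : 0 < c / pnorm x by rewrite divr_gt0.
have /= := hd ((c / pnorm x) *: x); rewrite (pnorm_pow_lt hp)// sub0r pnormN.
rewrite pnormZ linearZ pnormZ gtr0_norm// divfK//.
have -> : c < d `^ p^-1 by rewrite ltr_pdivrMr// ltr_pMr ?powR_gt0// ltr1n.
move=> /(_ isT); rewrite mulrAC ltr_pdivrMr// mul1r => /ltW.
by rewrite ler_pdivlMl.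
Qed.

Lemma pbounded_continuous (T : {linear E -> F}) (k : R) :
  (forall x, pnorm (T x) <= k * pnorm x) -> continuous T.
Proof.
move=> hk x A /(nbhs_pnormP hp)[e e0 eA].
pose k' := `|k| + 1; have k'0 : 0 < k' by rewrite ltr_wpDl.
apply/(nbhs_pnormP hp); exists ((e `^ p^-1 / k') `^ p).
  by rewrite powR_gt0// divr_gt0// powR_gt0.
move=> y; rewrite (ltr_powRr hp) ?pnorm_ge0 ?divr_ge0 ?powR_ge0// ?ltW//.
rewrite ltr_pdivlMr// => xy; apply: eA.
rewrite (pnorm_pow_lt hp)// -linearB; apply: le_lt_trans xy.
apply: le_trans (hk _) _; rewrite mulrC ler_wpM2l ?pnorm_ge0//.
by apply: le_trans (ler_norm _) _; rewrite lerDl.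
Qed.

Lemma opnorm_le (T : E -> F) (k : R) : 0 <= k ->
  (forall x, pnorm (T x) <= k * pnorm x) -> opnorm T <= k.
Proof.
move=> k0 hk; apply: ge_sup => [|_ [x /= x1 <-]].
  by exists (pnorm (T 0)), 0 => //=; rewrite pnorm0.
by apply: le_trans (hk x) _; rewrite ler_piMr.
Qed.

Lemma pnorm_le_opnorm (T : {linear E -> F}) (k : R) :
  (forall x, pnorm (T x) <= k * pnorm x) ->
  forall x, pnorm (T x) <= opnorm T * pnorm x.
Proof.
move=> hk x; have [x0|x0] := eqVneq (pnorm x) 0.
  by rewrite (pnorm0_eq0 _ x0) linear0 !pnorm0 mulr0.
have xgt0 : 0 < pnorm x by rewrite lt_def x0 pnorm_ge0.
rewrite -ler_pdivrMr// mulrC -[X in X * _]gtr0_norm ?invr_gt0//.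
rewrite -pnormZ -linearZ; apply: ub_le_sup.
  exists `|k| => _ [y /= y1 <-]; apply: le_trans (hk y) _.
  apply: le_trans (ler_wpM2r (pnorm_ge0 y) (ler_norm k)) _.
  by rewrite ler_piMr.
exists ((pnorm x)^-1 *: x) => //=.
by rewrite pnormZ gtr0_norm ?invr_gt0// mulVf.
Qed.

Lemma opnorm_ge0 (T : E -> F) (k : R) :
  (forall x, pnorm (T x) <= k * pnorm x) -> 0 <= opnorm T.
Proof.
move=> hk; apply: le_trans (pnorm_ge0 (T 0)) _; apply: ub_le_sup.
  exists `|k| => _ [y /= y1 <-]; apply: le_trans (hk y) _.
  apply: le_trans (ler_wpM2r (pnorm_ge0 y) (ler_norm k)) _.
  by rewrite ler_piMr.
by exists 0 => //=; rewrite pnorm0.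
Qed.

End BoundedOperators.

Lemma pbanach_seq_cvg (R : realType) (p : R) (hp : 0 < p) (E : pbanachType p)
    (u : nat -> E) : vanishing (fun m n => pnorm (u m - u n) `^ p) ->
  exists l, null (fun x : E => pnorm x `^ p) (fun n => u n - l).
Proof.
move=> /(cauchy_pnorm_seq hp)/pbanach_cauchy_cvg[l ul]; exists l.
apply/cvgr0Pnorm_lt => e e0.
have : nbhs l [set y | pnorm (l - y) `^ p < e].
  by apply/(nbhs_pnormP hp); exists e.
move=> /ul; apply: (filterS (F := \oo)) => n /=.
by rewrite ger0_norm ?powR_ge0// pnormB.
Qed.

Lemma pnorm_gauge (R : realType) (p : R) (X : pbanachLatticeType p) :
  0 < p -> lattice_gauge p (fun x : X => pnorm x `^ p).
Proof.
move=> hp; split=> [x y|a x|x y xy]; first exact: ler_pnormD.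
  by rewrite pnormZ powRM ?pnorm_ge0.
by rewrite ler_powRr ?pnorm_ge0 ?ler_pnorm_vabs.
Qed.

(** * Completion of a vector lattice for a lattice gauge *)

Section Completion.
Variables (R : realType) (p : R).
Hypothesis hp : 0 < p.
Variables (F : vectorLatticeType R) (Q : F -> R).
Hypothesis hQ : lattice_gauge p Q.

Record cauchy_seq := CauchySeq {
  cseq :> nat -> F ;
  cseqP : vanishing (fun m n => Q (cseq m - cseq n))
}.

HB.instance Definition _ := gen_eqMixin cauchy_seq.
HB.instance Definition _ := gen_choiceMixin cauchy_seq.

Lemma cauchy_seq_eq (s t : cauchy_seq) : s =1 t -> s = t.
Proof.
case: s t => [s hs] [t ht] /= /funext st; case: _ / st in ht *.
by congr CauchySeq; exact: Prop_irrelevance.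
Qed.

Fact cst_subproof (x : F) : vanishing (fun m n : nat => Q (x - x)).
Proof. by rewrite subrr (gauge0 hp hQ); exact: vanishing0. Qed.

Fact add_subproof (s t : cauchy_seq) :
  vanishing (fun m n => Q ((s m + t m) - (s n + t n))).
Proof.
apply: le_vanishing (vanishingD (cseqP s) (cseqP t)) => m n.
by rewrite opprD addrACA; exact: (gaugeD hQ).
Qed.

Fact scale_subproof (a : R) (s : cauchy_seq) :
  vanishing (fun m n => Q (a *: s m - a *: s n)).
Proof.
apply: le_vanishing (vanishingZ (powR_ge0 `|a| p) (cseqP s)) => m n.
by rewrite -scalerBr (gaugeZ hQ).
Qed.

Fact vjoin_subproof (s t : cauchy_seq) :
  vanishing (fun m n => Q (vjoin (s m) (t m) - vjoin (s n) (t n))).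
Proof.
apply: le_vanishing (vanishingD (cseqP s) (cseqP t)) => m n.
exact: (gauge_vjoin hQ).
Qed.

Definition cseq_cst x := CauchySeq (cst_subproof x).
Definition cseq_add s t := CauchySeq (add_subproof s t).
Definition cseq_scale a s := CauchySeq (scale_subproof a s).
Definition cseq_vjoin s t := CauchySeq (vjoin_subproof s t).

Definition cseq_equiv (s t : cauchy_seq) : bool :=
  `[< null Q (fun n => s n - t n) >].

Fact cseq_equiv_refl : reflexive cseq_equiv.
Proof.
move=> s; apply/asboolP; apply: (null_le hp hQ) (null0 hp hQ) => n.
by rewrite subrr.
Qed.

Fact cseq_equiv_sym : symmetric cseq_equiv.
Proof.
by move=> s t; apply/asboolP/asboolP; exact: (null_sub_sym hp hQ).
Qed.

Fact cseq_equiv_trans : transitive cseq_equiv.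
Proof.
move=> t s u /asboolP st /asboolP tu; apply/asboolP.
exact: (null_sub_trans hp hQ) st tu.
Qed.

Canonical cseq_equivRel :=
  EquivRel cseq_equiv cseq_equiv_refl cseq_equiv_sym cseq_equiv_trans.

Definition completion := {eq_quot cseq_equiv}%qT.
HB.instance Definition _ := Choice.on completion.

Definition climit (s : cauchy_seq) : completion :=
  (\pi_({eq_quot cseq_equiv}) s)%qT.
Definition crepr (x : completion) : cauchy_seq := repr x.

Lemma creprK x : climit (crepr x) = x.
Proof. exact: reprK. Qed.

Lemma climitP s t : climit s = climit t <-> null Q (fun n => s n - t n).
Proof. by split=> [/eqmodP/asboolP|st]; last exact/eqmodP/asboolP. Qed.

Lemma crepr_climit s : null Q (fun n => crepr (climit s) n - s n).
Proof. by apply/climitP; rewrite creprK. Qed.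

Definition cadd x y := climit (cseq_add (crepr x) (crepr y)).
Definition cscale a x := climit (cseq_scale a (crepr x)).
Definition cjoin x y := climit (cseq_vjoin (crepr x) (crepr y)).

Lemma caddE s t : cadd (climit s) (climit t) = climit (cseq_add s t).
Proof.
apply/climitP => /=.
apply: (null_le hp hQ) (nullD hp hQ (crepr_climit s) (crepr_climit t)) => n.
by rewrite opprD addrACA.
Qed.

Lemma cscaleE a s : cscale a (climit s) = climit (cseq_scale a s).
Proof.
apply/climitP => /=.
apply: (null_le hp hQ) (nullZ hp hQ a (crepr_climit s)) => n.
by rewrite scalerBr.
Qed.

Lemma cjoinE s t : cjoin (climit s) (climit t) = climit (cseq_vjoin s t).
Proof.
by apply/climitP => /=; apply: (null_vjoin hp hQ); exact: crepr_climit.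
Qed.

(** This reduces the laws of the completion to the laws of [F], which hold
    termwise. *)
Lemma climit_ind (P : completion -> Prop) :
  (forall s, P (climit s)) -> forall x, P x.
Proof. by move=> h x; rewrite -[x]creprK. Qed.

Fact caddA : associative cadd.
Proof.
elim/climit_ind=> s; elim/climit_ind=> t; elim/climit_ind=> u.
by rewrite !caddE; congr climit; apply: cauchy_seq_eq => n /=; rewrite addrA.
Qed.

Fact caddC : commutative cadd.
Proof.
elim/climit_ind=> s; elim/climit_ind=> t.
by rewrite !caddE; congr climit; apply: cauchy_seq_eq => n /=; rewrite addrC.
Qed.

Fact cadd0 : left_id (climit (cseq_cst 0)) cadd.
Proof.
elim/climit_ind=> s.
by rewrite !caddE; congr climit; apply: cauchy_seq_eq => n /=; rewrite add0r.
Qed.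

Fact caddN : left_inverse (climit (cseq_cst 0)) (cscale (- 1)) cadd.
Proof.
elim/climit_ind=> s; rewrite !cscaleE !caddE; congr climit.
by apply: cauchy_seq_eq => n /=; rewrite scaleN1r addNr.
Qed.

HB.instance Definition _ := GRing.isZmodule.Build completion
  caddA caddC cadd0 caddN.

Fact cscaleA a b x : cscale a (cscale b x) = cscale (a * b) x.
Proof.
elim/climit_ind: x => s; rewrite !cscaleE; congr climit.
by apply: cauchy_seq_eq => n /=; rewrite scalerA.
Qed.

Fact cscale1 : left_id 1 cscale.
Proof.
elim/climit_ind=> s; rewrite !cscaleE; congr climit.
by apply: cauchy_seq_eq => n /=; rewrite scale1r.
Qed.

Fact cscaleDr : right_distributive cscale +%R.
Proof.
move=> a; elim/climit_ind=> s; elim/climit_ind=> t; rewrite -[+%R]/cadd.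
rewrite !(caddE, cscaleE); congr climit.
by apply: cauchy_seq_eq => n /=; rewrite scalerDr.
Qed.

Fact cscaleDl x : {morph cscale^~ x : a b / a + b}.
Proof.
elim/climit_ind: x => s a b; rewrite -[LHS]/(cscale (a + b) (climit s)).
rewrite -[RHS]/(cadd (cscale a (climit s)) (cscale b (climit s))).
rewrite !(caddE, cscaleE); congr climit.
by apply: cauchy_seq_eq => n /=; rewrite scalerDl.
Qed.

HB.instance Definition _ := GRing.Zmodule_isLmodule.Build R completion
  cscaleA cscale1 cscaleDr cscaleDl.

Lemma climitD s t : climit s + climit t = climit (cseq_add s t).
Proof. exact: caddE. Qed.

Lemma climitZ a s : a *: climit s = climit (cseq_scale a s).
Proof. exact: cscaleE. Qed.

Fact cjoinC x y : cjoin x y = cjoin y x.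
Proof.
elim/climit_ind: x => s; elim/climit_ind: y => t; rewrite !cjoinE.
by congr climit; apply: cauchy_seq_eq => n /=; rewrite vjoinC.
Qed.

Fact cjoinA x y z : cjoin x (cjoin y z) = cjoin (cjoin x y) z.
Proof.
elim/climit_ind: x => s; elim/climit_ind: y => t; elim/climit_ind: z => u.
rewrite !cjoinE; congr climit.
by apply: cauchy_seq_eq => n /=; rewrite vjoinA.
Qed.

Fact cjoinxx x : cjoin x x = x.
Proof.
elim/climit_ind: x => s; rewrite !cjoinE; congr climit.
by apply: cauchy_seq_eq => n /=; rewrite vjoinxx.
Qed.

Fact cjoinDr x y z : cjoin x y + z = cjoin (x + z) (y + z).
Proof.
elim/climit_ind: x => s; elim/climit_ind: y => t; elim/climit_ind: z => u.
rewrite !(cjoinE, climitD); congr climit.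
by apply: cauchy_seq_eq => n /=; rewrite vjoinDr.
Qed.

Fact cjoinZ (a : R) x y : 0 <= a -> a *: cjoin x y = cjoin (a *: x) (a *: y).
Proof.
elim/climit_ind: x => s; elim/climit_ind: y => t a0.
rewrite (climitZ a s) (climitZ a t) !cjoinE climitZ; congr climit.
by apply: cauchy_seq_eq => n /=; rewrite vjoinZ.
Qed.

HB.instance Definition _ := Lmodule_isVectorLattice.Build R completion
  cjoinC cjoinA cjoinxx cjoinDr cjoinZ.

Lemma climit_vjoin s t : vjoin (climit s) (climit t) = climit (cseq_vjoin s t).
Proof. exact: cjoinE. Qed.

Lemma gauge_is_cvg (s : cauchy_seq) : cvg (Q (s n) @[n --> \oo]).
Proof.
apply/cauchy_cvgP/cauchy_ballP => e e0; near_simpl.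
have [N hN] := cseqP s e0.
exists ([set n | (N <= n)%N], [set n | (N <= n)%N]).
  by split; exists N.
move=> [m n] /= [Nm Nn]; rewrite /ball/=.
exact: le_lt_trans (gauge_dist hQ _ _) (hN _ _ Nm Nn).
Qed.
(** The continuous extension of [Q]: [cgauge_cvg] shows that the limit does not
    depend on the representative. *)
Definition cgauge (x : completion) : R := lim (Q (crepr x n) @[n --> \oo]).

Lemma cgauge_cvg (s : cauchy_seq) : Q (s n) @[n --> \oo] --> cgauge (climit s).
Proof.
have h : (Q (s n) - Q (crepr (climit s) n)) @[n --> \oo] --> (0 : R).
  apply/cvgr0Pnorm_lt => e e0.
  have /cvgr0Pnorm_lt/(_ _ e0) := crepr_climit s.
  apply: filterS => n /=; rewrite ger0_norm ?(gauge_ge0 hp hQ)//.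
  by apply: le_lt_trans; rewrite (gaugeC hQ) (gauge_dist hQ).
have -> : (fun n => Q (s n)) =
    (fun n => Q (s n) - Q (crepr (climit s) n) + Q (crepr (climit s) n)).
  by apply/funext => n; rewrite subrK.
rewrite -[cgauge _]add0r; apply: (cvgD h).
exact: (@gauge_is_cvg (crepr (climit s))).
Qed.
Lemma cgauge_unique (s : cauchy_seq) (l : R) :
  Q (s n) @[n --> \oo] --> l -> cgauge (climit s) = l.
Proof.
by move=> sl; rewrite -(cvg_lim _ sl)// -(cvg_lim _ (@cgauge_cvg s)).
Qed.

Fact cgauge_lattice_gauge : lattice_gauge p cgauge.
Proof.
split.
- elim/climit_ind=> s; elim/climit_ind=> t; rewrite climitD.
  apply: (ler_cvg_to (@cgauge_cvg (cseq_add s t))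
    (cvgD (@cgauge_cvg s) (@cgauge_cvg t))).
  by near=> n; exact: (gaugeD hQ).
- move=> a; elim/climit_ind=> s; rewrite climitZ; apply: cgauge_unique => /=.
  under eq_fun do rewrite (gaugeZ hQ).
  by apply: cvgMl_tmp; exact: (@cgauge_cvg s).
(* As [|x| <= |y|] says that the join of [|x|] and [|y|] is [|y|], the gauge of
   [y] is a limit of gauges that bound those of the terms of [x]. *)
- elim/climit_ind=> s; elim/climit_ind=> t /vjoin_idPl.
  rewrite /vabs -![- climit _]scaleN1r !climitZ !climit_vjoin => /climitP/=.
  under eq_fun do rewrite !scaleN1r -!/(vabs _).
  move=> st.
  apply: (ler_cvg_to (@cgauge_cvg s)).
    rewrite -[X in _ --> X]addr0; apply: (cvgD (@cgauge_cvg t) st).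
  near=> n; rewrite -[leRHS]/(Q (t n) +
    Q (vjoin (vabs (s n)) (vabs (t n)) - vabs (t n))).
  apply: (@le_trans _ _ (Q (vjoin (vabs (s n)) (vabs (t n))))).
    apply: (gauge_le hQ); rewrite [leRHS]vabs_id ?le_vjoinl//.
    by apply: le_trans (vabs_ge0 (s n)) _; exact: le_vjoinl.
  rewrite -[Q (t n)](gauge_abs hQ) addrC.
  rewrite -[in leLHS](subrK (vabs (t n)) (vjoin _ _)).
  exact: (gaugeD hQ).
Unshelve. all: by end_near. Qed.

Definition cembed (x : F) : completion := climit (cseq_cst x).

Lemma cgauge_cembed x : cgauge (cembed x) = Q x.
Proof. by apply: cgauge_unique => /=; exact: cvg_cst. Qed.

Fact cembed_is_linear : linear cembed.
Proof.
move=> a x y; rewrite /cembed climitZ climitD; congr climit.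
exact: cauchy_seq_eq.
Qed.

HB.instance Definition _ := GRing.isLinear.Build R F completion _ cembed
  cembed_is_linear.

Lemma cembed_vjoin x y : cembed (vjoin x y) = vjoin (cembed x) (cembed y).
Proof. by rewrite climit_vjoin; congr climit; exact: cauchy_seq_eq. Qed.

Lemma cgauge_eq0 x : cgauge x = 0 -> x = 0.
Proof.
elim/climit_ind: x => s s0; apply/climitP => /=.
have := @cgauge_cvg s; rewrite s0; apply: (null_le hp hQ) => n.
by rewrite subr0.
Qed.

(** A Cauchy sequence converges to its own class. *)
Lemma cembed_dense x : null cgauge (fun n => cembed (crepr x n) - x).
Proof.
rewrite -{2}[x]creprK; set s := crepr x.
apply/cvgr0Pnorm_le => e e0; have [N hN] := cseqP s e0; exists N => // n Nn /=.
rewrite ger0_norm ?(gauge_ge0 hp cgauge_lattice_gauge)//.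
rewrite /cembed -[- climit s]scaleN1r climitZ climitD.
apply: (cvgr_to_le (@cgauge_cvg _)); exists N => // m Nm /=.
by rewrite scaleN1r ltW// hN.
Qed.

End Completion.

Section CompletionPBanach.
Variables (R : realType) (p : R).
Hypothesis hp : 0 < p.
Variables (F : vectorLatticeType R) (Q : F -> R).
Hypothesis hQ : lattice_gauge p Q.

Local Notation C := (completion hp hQ).
Local Notation gauge := (@cgauge R p hp F Q hQ).
Local Notation gaugeP := (cgauge_lattice_gauge hp hQ).

Definition cpnorm (x : C) : R := gauge x `^ p^-1.

Lemma cpnorm_pow x : cpnorm x `^ p = gauge x.
Proof. exact/(powRVK hp)/(gauge_ge0 hp gaugeP). Qed.

Lemma cpnorm_lt x e : 0 < e -> (cpnorm x < e) = (gauge x < e `^ p).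
Proof.
by move=> e0; rewrite -cpnorm_pow (ltr_powRr hp) ?powR_ge0// ltW.
Qed.

Fact cpnorm_ge0 x : 0 <= cpnorm x.
Proof. exact: powR_ge0. Qed.

Fact cpnorm0_eq0 x : cpnorm x = 0 -> x = 0.
Proof. by move=> /powR_eq0_eq0; exact: cgauge_eq0. Qed.

Fact cpnormZ (a : R) x : cpnorm (a *: x) = `|a| * cpnorm x.
Proof.
rewrite /cpnorm (gaugeZ gaugeP) powRM ?powR_ge0 ?(gauge_ge0 hp gaugeP)//.
by rewrite (powRKV hp).
Qed.

Fact ler_cpnormD x y : cpnorm (x + y) `^ p <= cpnorm x `^ p + cpnorm y `^ p.
Proof.
by rewrite (cpnorm_pow (x + y)) (cpnorm_pow x) (cpnorm_pow y) (gaugeD gaugeP).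
Qed.

Definition centourage : set_system (C * C) := entourage_ (ball_ cpnorm).

Fact centourage_filter : Filter centourage.
Proof.
apply: filter_from_filter; first by exists 1 => /=.
move=> d e /= d0 e0; exists (Num.min d e); first by rewrite /= lt_min d0.
by move=> [x y] /=; rewrite lt_min => /andP[].
Qed.

Fact centourage_diagonal A : centourage A -> diagonal `<=` A.
Proof.
move=> [e /= e0 eA] [x y] /diagonalP; rewrite /= => ->; apply: eA => /=.
by rewrite subrr cpnorm_lt// (gauge0 hp gaugeP) powR_gt0.
Qed.

Fact centourage_inv A : centourage A -> centourage (A^-1)%relation.
Proof.
move=> [e /= e0 eA]; exists e => //= -[x y] /= xy; apply: eA => /=.
by rewrite cpnorm_lt// (gaugeC gaugeP) -cpnorm_lt.
Qed.

Fact centourage_split A : centourage A ->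
  exists2 B, centourage B & (B \; B `<=` A)%relation.
Proof.
move=> [e /= e0 eA]; have d0 : 0 < e `^ p / 2 by rewrite divr_gt0// powR_gt0.
exists [set xy | gauge (xy.1 - xy.2) < e `^ p / 2].
  exists ((e `^ p / 2) `^ p^-1); first exact: powR_gt0.
  by move=> xy /=; rewrite cpnorm_lt ?powR_gt0// (powRVK hp)// ltW.
move=> [x z] [y /= xy yz]; apply: eA; rewrite /= cpnorm_lt// [_ `^ p]splitr.
by apply: le_lt_trans (gauge_tri gaugeP y x z) _; exact: ltrD.
Qed.

HB.instance Definition _ := isUniform.Build C
  centourage_filter centourage_diagonal centourage_inv centourage_split.

HB.instance Definition _ := isPNormed.Build R p C
  cpnorm_ge0 cpnorm0_eq0 cpnormZ ler_cpnormD erefl.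

Lemma cpnormE (x : C) : pnorm x `^ p = gauge x.
Proof. exact: cpnorm_pow. Qed.

(** A Cauchy filter contains a ball of gauge radius [n.+1%:R^-1], whose centre
    is as close to some [a n] in [F]; the sequence [a] is Cauchy and the filter
    converges to its class. *)
Fact completion_complete (G : set_system C) :
  ProperFilter G -> cauchy G -> exists x : C, G --> x.
Proof.
move=> GF Gc.
have eps_gt0 n : 0 < n.+1%:R^-1 :> R by rewrite invr_gt0.
have approx n : exists a : F,
    G [set y | gauge (cembed hp hQ a - y) < n.+1%:R^-1 + n.+1%:R^-1].
  have [x Gx] := cauchy_pnorm hp GF Gc (eps_gt0 n).
  have /cvgr0Pnorm_lt/(_ _ (eps_gt0 n))[N _ hN] := cembed_dense x.
  exists (crepr x N); apply: filterS Gx => y /= xy.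
  apply: le_lt_trans (gauge_tri gaugeP x _ _) _.
  apply: ltrD; last by rewrite -(cpnormE (x - y)).
  by have /= := hN N (leqnn N); rewrite ger0_norm ?(gauge_ge0 hp gaugeP).
have [a Ga] := choice approx.
have small e : 0 < e -> exists N, forall n, (N <= n)%N ->
    (n.+1%:R^-1 + n.+1%:R^-1 : R) < e.
  move=> e0; have e2 : 0 < e / 2 by rewrite divr_gt0.
  have /cvgr0Pnorm_lt/(_ _ e2)[N _ hN] := @cvg_harmonic R.
  exists N => k Nk; have /= := hN k Nk; rewrite ger0_norm// => hk.
  by rewrite [e]splitr ltrD.
have aC : vanishing (fun m n => Q (a m - a n)).
  move=> e e0; have [N hN] := small _ (divr_gt0 e0 (ltr0Sn _ 1)).
  exists N => m n Nm Nn.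
  have [y [/= my ny]] := filter_ex (filterI (Ga m) (Ga n)).
  rewrite -(cgauge_cembed hp hQ) linearB /=.
  apply: le_lt_trans (gauge_tri gaugeP y _ _) _.
  rewrite [e]splitr ltrD//; first exact: lt_trans my (hN m Nm).
  by rewrite (gaugeC gaugeP); exact: lt_trans ny (hN n Nn).
pose s := CauchySeq aC; exists (climit hp hQ s).
apply: (cvg_pnormP hp) => e e0.
have e2 : 0 < e / 2 by rewrite divr_gt0.
have [N hN] := small _ e2; have [N1 hN1] := aC _ e2.
apply: filterS (Ga (maxn N N1)) => y /= ay.
rewrite (cpnormE (climit hp hQ s - y)).
apply: le_lt_trans (gauge_tri gaugeP (cembed hp hQ (a (maxn N N1))) _ _) _.
rewrite [e]splitr ler_ltD//; last exact: lt_trans ay (hN _ (leq_maxl _ _)).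
rewrite /cembed -[- climit _ _ _]scaleN1r climitZ climitD.
apply: (cvgr_to_le (@cgauge_cvg _ _ _ _ _ _ _)); exists N1 => // m Nm /=.
by rewrite scaleN1r ltW// hN1 ?leq_maxr.
Qed.

HB.instance Definition _ := PNormed_isPBanach.Build R p C completion_complete.

Fact ler_cpnorm_vabs (x y : C) : vabs x <= vabs y -> pnorm x <= pnorm y.
Proof.
move=> xy; rewrite -(ler_powRr hp (pnorm_ge0 x) (pnorm_ge0 y)).
by rewrite (cpnormE x) (cpnormE y); exact: (gauge_le gaugeP xy).
Qed.

HB.instance Definition _ := isPBanachLattice.Build R p C ler_cpnorm_vabs.

End CompletionPBanach.

Section CompletionExtension.
Variables (R : realType) (p : R).
Hypothesis hp : 0 < p.
Variables (F : vectorLatticeType R) (Q : F -> R).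
Hypothesis hQ : lattice_gauge p Q.
Variable X : pbanachLatticeType p.

Local Notation C := (completion hp hQ).
Local Notation QX := (fun x : X => pnorm x `^ p).
Local Notation QXP := (pnorm_gauge X hp).

Lemma completion_map_unique (S T : {linear C -> X}) :
  continuous S -> continuous T ->
  (forall x, S (cembed hp hQ x) = T (cembed hp hQ x)) -> forall x, S x = T x.
Proof.
move=> /(continuous_pbounded hp)[k k0 Sk] /(continuous_pbounded hp)[l l0 Tl].
move=> ST x.
apply/eqP; rewrite -subr_eq0; apply/eqP/pnorm0_eq0/(powR_eq0_eq0 (p := p)).
apply: (null_cst (Q := QX)).
apply: (null_le hp QXP (v := fun n =>
  (k `^ p + l `^ p) * cgauge (cembed hp hQ (crepr x n) - x))).
  move=> n; set c := cembed _ _ _.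
  have -> : S x - T x = (S x - S c) + (T c - T x).
    by rewrite ST addrA subrK.
  apply: le_trans (ler_pnormD _ _) _; rewrite -!linearB /= mulrDl.
  rewrite -cpnormE -!powRM ?pnorm_ge0//.
  apply: lerD; rewrite ler_powRr ?mulr_ge0 ?pnorm_ge0//.
  by rewrite -(pnormB x).
rewrite -[X in _ --> X](mulr0 (k `^ p + l `^ p)).
by apply: cvgMl_tmp; exact: cembed_dense.
Qed.

Variables (h : {linear F -> X}) (k : R).
Hypothesis hU : {morph h : x y / vjoin x y >-> vjoin x y}.
Hypothesis k0 : 0 <= k.
Hypothesis hk : forall x, pnorm (h x) `^ p <= k * Q x.

Lemma null_image (u : nat -> F) : null Q u -> null QX (fun n => h (u n)).
Proof.
move=> u0; apply: (null_le hp QXP (v := fun n => k * Q (u n))) => [n|].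
  exact: hk.
by rewrite -[X in _ --> X](mulr0 k); exact: cvgMl_tmp.
Qed.

Lemma image_cvg (s : cauchy_seq Q) : exists l, null QX (fun n => h (s n) - l).
Proof.
apply: (pbanach_seq_cvg hp); apply: le_vanishing (vanishingZ k0 (cseqP s)).
by move=> m n; rewrite -linearB hk.
Qed.

Definition cextend (x : C) : X :=
  xget 0 [set l | null QX (fun n => h (crepr x n) - l)].

Lemma cextend_unique (s : cauchy_seq Q) (l : X) :
  null QX (fun n => h (s n) - l) -> cextend (climit hp hQ s) = l.
Proof.
move=> sl; set x := climit hp hQ s.
have xl : null QX (fun n => h (crepr x n) - cextend x).
  have [l' xl'] := image_cvg (crepr x).
  by apply: (@xgetI _ 0 [set l | null QX (fun n => h (crepr x n) - l)] l' xl').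
have rs : null QX (fun n => h (s n) - h (crepr x n)).
  apply: (null_sub_sym hp QXP).
  have := null_image (@crepr_climit _ _ hp _ _ hQ s).
  by apply: (null_le hp QXP) => n; rewrite linearB.
have := null_sub_trans hp QXP rs xl => sx.
have := null_sub_trans hp QXP (null_sub_sym hp QXP sx) sl.
move=> /(null_cst (Q := QX))/powR_eq0_eq0/pnorm0_eq0/eqP.
by rewrite subr_eq0 => /eqP.
Qed.

Lemma cextend_cvg (s : cauchy_seq Q) :
  null QX (fun n => h (s n) - cextend (climit hp hQ s)).
Proof. by have [l sl] := image_cvg s; rewrite (cextend_unique sl). Qed.

Fact cextend_is_linear : linear cextend.
Proof.
move=> a; elim/climit_ind=> s; elim/climit_ind=> t.
rewrite climitZ climitD; apply: cextend_unique.
apply: (null_le hp QXP)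
  (nullD hp QXP (nullZ hp QXP a (@cextend_cvg s)) (@cextend_cvg t)) => n.
by rewrite /= linearD linearZ /= scalerBr opprD addrACA.
Qed.

Lemma cextend_vjoin : {morph cextend : x y / vjoin x y >-> vjoin x y}.
Proof.
elim/climit_ind=> s; elim/climit_ind=> t.
rewrite climit_vjoin; apply: cextend_unique.
apply: (null_le hp QXP)
  (null_vjoin hp QXP (@cextend_cvg s) (@cextend_cvg t)) => n.
by rewrite /= hU.
Qed.

Lemma cextend_cembed x : cextend (cembed hp hQ x) = h x.
Proof.
apply: cextend_unique; apply: (null_le hp QXP) (null0 hp QXP) => n /=.
by rewrite subrr.
Qed.

Lemma cextend_bound x : pnorm (cextend x) `^ p <= k * cgauge x.
Proof.
elim/climit_ind: x => s; set l := cextend _.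
have sl : QX (h (s n)) @[n --> \oo] --> QX l.
  apply/cvgrPdist_lt => e e0; have /cvgr0Pnorm_lt/(_ _ e0) := @cextend_cvg s.
  apply: filterS => n /=; rewrite ger0_norm ?powR_ge0// -/l.
  by apply: le_lt_trans; rewrite distrC (gauge_dist QXP).
have kl : k * Q (s n) @[n --> \oo] --> k * cgauge (climit hp hQ s).
  by apply: cvgMl_tmp; exact: (@cgauge_cvg _ _ hp _ _ hQ s).
apply: (ler_cvg_to sl kl).
by near=> n; exact: hk.
Unshelve. all: by end_near. Qed.

(** The universal property of the completion: a bounded map sends Cauchy
    sequences to Cauchy sequences, and joins, sums and gauges pass to the
    limit. *)
Lemma completion_extension : exists H : {linear C -> X},
  [/\ {morph H : x y / vjoin x y >-> vjoin x y},
      forall x, H (cembed hp hQ x) = h x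
    & forall x, pnorm (H x) `^ p <= k * cgauge x].
Proof.
pose H : {linear C -> X} :=
  HB.pack cextend (GRing.isLinear.Build R C X _ cextend cextend_is_linear).
exists H; split.
- exact: cextend_vjoin.
- exact: cextend_cembed.
- exact: cextend_bound.
Qed.

End CompletionExtension.

(** * The free vector lattice *)

Section FreeVectorLattice.
Variables (R : realType) (E : lmodType R).

(** Meets, zero and opposites are derived operations. *)
Inductive lterm : Type :=
| Gen of E
| Add of lterm & lterm
| Scale of R & lterm
| Join of lterm & lterm.

HB.instance Definition _ := gen_eqMixin lterm.
HB.instance Definition _ := gen_choiceMixin lterm.

Fixpoint lterm_eval (X : vectorLatticeType R) (T : E -> X) (t : lterm) : X :=
  match t with
  | Gen e => T e
  | Add t s => lterm_eval T t + lterm_eval T s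
  | Scale a t => a *: lterm_eval T t
  | Join t s => vjoin (lterm_eval T t) (lterm_eval T s)
  end.

(** Equality under every interpretation in every vector lattice, rather than in
    the scalars only: the laws of vector lattices and the universal property
    then hold by construction, whereas an equivalence defined by real-valued
    interpretations would require a representation theorem to be interpreted in
    an arbitrary vector lattice. *)
Definition lterm_equiv (t s : lterm) : bool :=
  `[< forall (X : vectorLatticeType R) (T : {linear E -> X}),
        lterm_eval T t = lterm_eval T s >].

Fact lterm_equiv_refl : reflexive lterm_equiv.
Proof. by move=> t; apply/asboolP. Qed.

Fact lterm_equiv_sym : symmetric lterm_equiv.
Proof. by move=> t s; apply/asboolP/asboolP => ts X T; rewrite ts. Qed.

Fact lterm_equiv_trans : transitive lterm_equiv.
Proof.
by move=> s t u /asboolP ts /asboolP su; apply/asboolP => X T; rewrite ts su.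
Qed.

Canonical lterm_equivRel :=
  EquivRel lterm_equiv lterm_equiv_refl lterm_equiv_sym lterm_equiv_trans.

Definition free_vlat := {eq_quot lterm_equiv}%qT.
HB.instance Definition _ := Choice.on free_vlat.

Definition fclass (t : lterm) : free_vlat := (\pi_({eq_quot lterm_equiv}) t)%qT.
Definition frepr (x : free_vlat) : lterm := repr x.

Definition feval (X : vectorLatticeType R) (T : E -> X) (x : free_vlat) : X :=
  lterm_eval T (frepr x).

Lemma fevalE (X : vectorLatticeType R) (T : {linear E -> X}) t :
  feval T (fclass t) = lterm_eval T t.
Proof.
have /eqmodP/asboolP : fclass (frepr (fclass t)) = fclass t by exact: reprK.
exact.
Qed.

Lemma feval_inj x y :
  (forall (X : vectorLatticeType R) (T : {linear E -> X}),
    feval T x = feval T y) -> x = y.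
Proof. by move=> xy; rewrite -[x]reprK -[y]reprK; apply/eqmodP/asboolP. Qed.

Definition fgen e := fclass (Gen e).
Definition fadd x y := fclass (Add (frepr x) (frepr y)).
Definition fscale a x := fclass (Scale a (frepr x)).
Definition fjoin x y := fclass (Join (frepr x) (frepr y)).

Let faddE (X : vectorLatticeType R) (T : {linear E -> X}) x y :
  feval T (fadd x y) = feval T x + feval T y.
Proof. exact: fevalE. Qed.

Let fscaleE (X : vectorLatticeType R) (T : {linear E -> X}) a x :
  feval T (fscale a x) = a *: feval T x.
Proof. exact: fevalE. Qed.

Let fjoinE (X : vectorLatticeType R) (T : {linear E -> X}) x y :
  feval T (fjoin x y) = vjoin (feval T x) (feval T y).
Proof. exact: fevalE. Qed.

Lemma feval_gen (X : vectorLatticeType R) (T : {linear E -> X}) e :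
  feval T (fgen e) = T e.
Proof. exact: fevalE. Qed.

Fact faddA : associative fadd.
Proof. by move=> x y z; apply: feval_inj => X T; rewrite !faddE addrA. Qed.

Fact faddC : commutative fadd.
Proof. by move=> x y; apply: feval_inj => X T; rewrite !faddE addrC. Qed.

Fact fadd0 : left_id (fgen 0) fadd.
Proof.
by move=> x; apply: feval_inj => X T; rewrite faddE feval_gen linear0 add0r.
Qed.

Fact faddN : left_inverse (fgen 0) (fscale (- 1)) fadd.
Proof.
move=> x; apply: feval_inj => X T.
by rewrite faddE fscaleE feval_gen linear0 scaleN1r addNr.
Qed.

HB.instance Definition _ := GRing.isZmodule.Build free_vlat
  faddA faddC fadd0 faddN.

Let fevalD (X : vectorLatticeType R) (T : {linear E -> X}) x y :
  feval T (x + y) = feval T x + feval T y.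
Proof. exact: faddE. Qed.

Fact fscaleA a b x : fscale a (fscale b x) = fscale (a * b) x.
Proof. by apply: feval_inj => X T; rewrite !fscaleE scalerA. Qed.

Fact fscale1 : left_id 1 fscale.
Proof. by move=> x; apply: feval_inj => X T; rewrite fscaleE scale1r. Qed.

Fact fscaleDr : right_distributive fscale +%R.
Proof.
by move=> a x y; apply: feval_inj => X T; rewrite !(fevalD, fscaleE) scalerDr.
Qed.

Fact fscaleDl x : {morph fscale^~ x : a b / a + b}.
Proof.
by move=> a b; apply: feval_inj => X T; rewrite !(fevalD, fscaleE) scalerDl.
Qed.

HB.instance Definition _ := GRing.Zmodule_isLmodule.Build R free_vlat
  fscaleA fscale1 fscaleDr fscaleDl.

Let fevalZ (X : vectorLatticeType R) (T : {linear E -> X}) a x :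
  feval T (a *: x) = a *: feval T x.
Proof. exact: fscaleE. Qed.

Fact feval_is_linear (X : vectorLatticeType R) (T : {linear E -> X}) :
  linear (feval T).
Proof. by move=> a x y; rewrite fevalD fevalZ. Qed.

HB.instance Definition _ (X : vectorLatticeType R) (T : {linear E -> X}) :=
  GRing.isLinear.Build R free_vlat X _ (feval T) (feval_is_linear T).

Fact fjoinC x y : fjoin x y = fjoin y x.
Proof. by apply: feval_inj => X T; rewrite !fjoinE vjoinC. Qed.

Fact fjoinA x y z : fjoin x (fjoin y z) = fjoin (fjoin x y) z.
Proof. by apply: feval_inj => X T; rewrite !fjoinE vjoinA. Qed.

Fact fjoinxx x : fjoin x x = x.
Proof. by apply: feval_inj => X T; rewrite !fjoinE vjoinxx. Qed.

Fact fjoinDr x y z : fjoin x y + z = fjoin (x + z) (y + z).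
Proof. by apply: feval_inj => X T; rewrite !(fjoinE, fevalD) vjoinDr. Qed.

Fact fjoinZ (a : R) x y : 0 <= a -> a *: fjoin x y = fjoin (a *: x) (a *: y).
Proof.
by move=> a0; apply: feval_inj => X T; rewrite !(fjoinE, fevalZ) vjoinZ.
Qed.

HB.instance Definition _ := Lmodule_isVectorLattice.Build R free_vlat
  fjoinC fjoinA fjoinxx fjoinDr fjoinZ.

Lemma feval_vjoin (X : vectorLatticeType R) (T : {linear E -> X}) :
  {morph feval T : x y / vjoin x y >-> vjoin x y}.
Proof. by move=> x y; exact: fjoinE. Qed.

Lemma feval_vabs (X : vectorLatticeType R) (T : {linear E -> X}) x :
  feval T (vabs x) = vabs (feval T x).
Proof. by rewrite /vabs feval_vjoin linearN. Qed.

Lemma feval_le (X : vectorLatticeType R) (T : {linear E -> X}) x y :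
  x <= y -> feval T x <= feval T y.
Proof. by move=> /vjoin_idPl <-; rewrite feval_vjoin le_vjoinl. Qed.

Fact fgen_is_linear : linear fgen.
Proof.
move=> a x y; apply: feval_inj => X T.
by rewrite fevalD fevalZ !feval_gen linearP.
Qed.

HB.instance Definition _ := GRing.isLinear.Build R E free_vlat _ fgen
  fgen_is_linear.

Lemma free_vlat_ind (P : free_vlat -> Prop) :
  (forall e, P (fgen e)) ->
  (forall x y, P x -> P y -> P (x + y)) ->
  (forall a x, P x -> P (a *: x)) ->
  (forall x y, P x -> P y -> P (vjoin x y)) ->
  forall x, P x.
Proof.
move=> Pgen PD PZ PU x.
suff Pclass t : P (fclass t) by rewrite -[x]reprK; exact: Pclass.
elim: t => [e|t Pt s Ps|a t Pt|t Pt s Ps].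
- exact: Pgen.
- have -> : fclass (Add t s) = fclass t + fclass s.
    by apply: feval_inj => X T; rewrite fevalD !fevalE.
  exact: PD.
- have -> : fclass (Scale a t) = a *: fclass t.
    by apply: feval_inj => X T; rewrite fevalZ !fevalE.
  exact: PZ.
- have -> : fclass (Join t s) = vjoin (fclass t) (fclass s).
    by apply: feval_inj => X T; rewrite feval_vjoin !fevalE.
  exact: PU.
Qed.

End FreeVectorLattice.

(** * Linear functionals and dominations *)

Fact real_leD2r (R : realType) (z x y : R^o) : x <= y -> x + z <= y + z.
Proof. by rewrite lerD2r. Qed.

Fact real_leZ2l (R : realType) (a : R) (x y : R^o) :
  0 <= a -> x <= y -> a *: x <= a *: y.
Proof. by move=> a0 xy; exact: ler_wpM2l. Qed.

HB.instance Definition _ (R : realType) := Order.POrder.copy R^o R.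

HB.instance Definition _ (R : realType) := isVectorLattice.Build R R^o
  (@real_leD2r R) (@real_leZ2l R) (fun x y z => le_min z x y)
  (fun x y z => ge_max z x y).

Lemma vabs_normr (R : realType) (a : R^o) : vabs a = `|a : R|.
Proof. exact: maxrN. Qed.

(** A subspace maximal among those that avoid [x] is a hyperplane complementary
    to the line of [x], and the coordinate along that line is the functional. *)
Lemma separating_functional (R : realType) (E : lmodType R) (x : E) :
  (forall phi : {linear E -> R^o}, phi x = 0) -> x = 0.
Proof.
move=> phix; apply: contrapT => x0.
pose P (A : set E) :=
  (forall (a : R) u v, A u -> A v -> A (a *: u + v)) /\ ~ A x.
have [|W [[Wlin Wx] Wmax]] := @Zorn_bigcup E P.
  move=> G GP Gtot; split; last by move=> [A /GP[_ Ax] /Ax].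
  move=> a u v [A GA Au] [B GB Bv].
  have [AB|BA] := Gtot _ _ GA GB.
    by exists B => //; apply: (GP _ GB).1 => //; exact: AB.
  by exists A => //; apply: (GP _ GA).1 => //; exact: BA.
have W0 : W 0.
  apply: contrapT => nW0.
  have Wempty u : ~ W u.
    move=> Wu; apply: nW0.
    by have := Wlin (-1) u u Wu Wu; rewrite scaleN1r addNr.
  apply: (Wmax [set 0]).
    by split=> [u /Wempty//|/(_ 0 erefl)].
  by split=> // a u v /= -> ->; rewrite scaler0 addr0.
have WZ a u : W u -> W (a *: u).
  by move=> Wu; have := Wlin a u 0 Wu W0; rewrite addr0.
have coord y : exists c : R, W (y - c *: x).
  apply: contrapT => nc.
  (* Otherwise the span of [W] and [y] still avoids [x]. *)
  apply: (Wmax [set u | exists a : R, W (u - a *: y)]).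
    split=> [u Wu|WB]; first by exists 0; rewrite scale0r subr0.
    apply: nc; exists 0; rewrite scale0r subr0; apply: WB => /=.
    by exists 1; rewrite scale1r subrr.
  split=> [a u v [b Wu] [c Wv]|[a Wxa]].
    exists (a * b + c); have := Wlin a _ _ Wu Wv.
    by rewrite scalerBr scalerA addrACA -opprD scalerDl.
  have [a0|a0] := eqVneq a 0.
    by apply: Wx; move: Wxa; rewrite a0 scale0r subr0.
  apply: nc; exists a^-1; have := WZ (- a^-1) _ Wxa.
  by rewrite scalerBr scalerA mulNr mulVf// !scaleNr scale1r opprK addrC.
have coord_unique y (c d : R) : W (y - c *: x) -> W (y - d *: x) -> c = d.
  move=> Wc Wd; apply/eqP; rewrite -subr_eq0; apply/negP => /negP cd; apply: Wx.
  have := WZ (c - d)^-1 _ (Wlin (-1) _ _ Wc Wd).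
  rewrite scaleN1r opprB addrA subrK -scalerBl scalerA mulVf//.
  by rewrite scale1r.
have [f fP] := choice coord.
have f_lin : linear (f : E -> R^o).
  move=> a u v; apply: (coord_unique (a *: u + v)); first exact: fP.
  have := Wlin a _ _ (fP u) (fP v).
  by rewrite scalerBr scalerA addrACA -opprD scalerDl.
pose phi : {linear E -> R^o} :=
  HB.pack (f : E -> R^o) (GRing.isLinear.Build R E R^o _ f f_lin).
have := phix phi; rewrite /= (coord_unique x (f x) 1 (fP x)).
  by move/eqP; rewrite oner_eq0.
by rewrite scale1r subrr.
Qed.

(** The hypothesis forces [x] to be a combination of the entries of [s] with
    coefficients of absolute value at most 1, which gives the inequality for
    every [p]-norm. The coefficients are found one at a time, as in the
    one-dimensional step of the Hahn-Banach theorem, with the functionals in the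
    role of the points. *)
Lemma pnorm_le_domination (R : realType) (p : R) (E : pnormedType p)
    (s : seq E) (x : E) : 0 < p ->
  (forall phi : {linear E -> R^o}, `|phi x| <= \sum_(e <- s) `|phi e|) ->
  pnorm x `^ p <= \sum_(e <- s) pnorm e `^ p.
Proof.
move=> hp; elim: s x => [|e s IH] x dom.
  rewrite (@separating_functional R E x) ?pnorm0 ?big_nil ?powR0 ?gt_eqF//.
  by move=> phi; have := dom phi; rewrite big_nil normr_le0 => /eqP.
pose N (phi : {linear E -> R^o}) : R := \sum_(e <- s) `|phi e|.
have N0 phi : 0 <= N phi by exact: sumr_ge0.
have NB (phi psi : {linear E -> R^o}) : N (phi \- psi) <= N phi + N psi.
  by rewrite -big_split/=; apply: ler_sum => i _; exact: ler_normB.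
have NZ (a : R) (phi : {linear E -> R^o}) : N (a \*: phi) = `|a| * N phi.
  by rewrite /N mulr_sumr; apply: eq_bigr => i _; rewrite -normrM.
have {}dom (phi : {linear E -> R^o}) : `|phi x| <= `|phi e| + N phi.
  by have := dom phi; rewrite big_cons.
(* The coefficient [c] of [e] must satisfy [-1 <= c <= 1] and
   [phi x - N phi <= c <= phi x + N phi] for each [phi] with [phi e = 1]; these
   intervals meet pairwise, so the supremum of their left ends is in all. *)
pose S := [set r : R | r = -1 \/
  exists phi : {linear E -> R^o}, phi e = 1 /\ r = phi x - N phi].
have S1 : ubound S 1.
  move=> _ [->|[phi [phie ->]]]; first by rewrite (le_trans (lerN10 _)).
  have := dom phi; rewrite phie normr1 lerBlDr; exact: le_trans (ler_norm _).
have Sphi (phi : {linear E -> R^o}) : phi e = 1 -> ubound S (phi x + N phi).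
  move=> phie _ [->|[psi [psie ->]]].
    have := dom phi; rewrite phie normr1 ler_norml => /andP[+ _].
    by rewrite -lerBlDr opprD.
  have := dom (psi \- phi); rewrite /= psie phie subrr normr0 add0r => h.
  rewrite lerBlDr -addrA -lerBlDl; apply: le_trans (ler_norm _) _.
  by apply: le_trans h _; rewrite addrC NB.
have Sub : has_sup S by split; [exists (-1); left | exists 1].
pose c := sup S.
have c1 : `|c| <= 1.
  rewrite ler_norml ge_sup ?andbT//; last by exists (-1); left.
  by apply: ub_le_sup; [exists 1 | left].
have cN (phi : {linear E -> R^o}) : phi e = 1 -> `|phi x - c| <= N phi.
  move=> phie; rewrite ler_norml lerBrDr lerBlDr; apply/andP; split.
    rewrite addrC -lerBrDr opprK; apply: ge_sup; first by exists (-1); left.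
    exact: Sphi.
  rewrite -lerBlDl; apply: ub_le_sup; first by exists 1.
  by right; exists phi.
have /IH IHx : forall phi : {linear E -> R^o}, `|phi (x - c *: e)| <= N phi.
  move=> phi; rewrite linearB linearZ /=.
  have [phie|phie] := eqVneq (phi e) 0.
    by have := dom phi; rewrite phie normr0 add0r scaler0 subr0.
  have := cN ((phi e)^-1 \*: phi); rewrite NZ /= => /(_ (mulVf phie)).
  have -> : phi x - c *: phi e = phi e * ((phi e)^-1 *: phi x - c).
    by rewrite mulrBr mulrA divff// mul1r [c *: _]mulrC.
  rewrite normrM => h.
  have -> : N phi = `|phi e| * (`|(phi e)^-1| * N phi).
    by rewrite mulrA -normrM divff// normr1 mul1r.
  by rewrite ler_wpM2l.
rewrite big_cons -[x in leLHS](subrK (c *: e)) addrC.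
apply: le_trans (ler_pnormD _ _) _.
rewrite lerD// ler_powRr ?pnorm_ge0// pnormZ.
by rewrite ler_piMl ?pnorm_ge0.
Qed.

(** * The free gauge *)

Section FreeGauge.
Variables (R : realType) (p : R).
Hypothesis hp : 0 < p.
Variable E : pnormedType p.

Local Notation L := (free_vlat E).

Definition dominating (x : L) : set (seq E) :=
  [set s | vabs x <= \sum_(e <- s) vabs (fgen e)].

Definition cost (s : seq E) : R := \sum_(e <- s) pnorm e `^ p.

(** The largest lattice gauge that is at most [pnorm e `^ p] at each
    generator [fgen e]. *)
Definition free_gauge (x : L) : R := inf (cost @` dominating x).

Lemma cost_ge0 s : 0 <= cost s.
Proof. by apply: sumr_ge0 => e _; exact: powR_ge0. Qed.

Lemma has_lbound_cost A : has_lbound (cost @` A).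
Proof. by exists 0 => _ [s _ <-]; exact: cost_ge0. Qed.

Lemma dominatingZ a x s :
  dominating x s -> dominating (a *: x) (map ( *:%R a) s).
Proof.
rewrite /dominating /= vabsZ big_map => xs.
under eq_bigr do rewrite linearZ vabsZ.
by rewrite -scaler_sumr; exact: vlat_leZ2l.
Qed.

Lemma cost_scale a s : cost (map ( *:%R a) s) = `|a| `^ p * cost s.
Proof.
rewrite /cost big_map mulr_sumr; apply: eq_bigr => e _.
by rewrite pnormZ powRM ?pnorm_ge0.
Qed.

Lemma cost_cat s t : cost (s ++ t) = cost s + cost t.
Proof. exact: big_cat. Qed.

Lemma dominating_cat x y z s t : vabs z <= vabs x + vabs y ->
  dominating x s -> dominating y t -> dominating z (s ++ t).
Proof.
rewrite /dominating /= big_cat /= => zxy xs yt.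
by apply: le_trans zxy _; exact: vleD.
Qed.

Lemma dominating_nonempty x : exists s, dominating x s.
Proof.
elim/free_vlat_ind: x => [e|x y [s xs] [t yt]|a x [s xs]|x y [s xs] [t yt]].
- by exists [:: e]; rewrite /dominating /= big_seq1.
- by exists (s ++ t); apply: dominating_cat xs yt; exact: vabsD.
- by exists (map ( *:%R a) s); exact: dominatingZ.
- exists (s ++ t); apply: dominating_cat xs yt.
  by have := vabs_vjoin_sub x y 0 0; rewrite vjoinxx !subr0.
Qed.

Lemma free_gauge_le x s : dominating x s -> free_gauge x <= cost s.
Proof. by move=> xs; apply: ge_inf; [exact: has_lbound_cost | exists s]. Qed.

Lemma free_gauge_ge x (k : R) : (forall s, dominating x s -> k <= cost s) ->
  k <= free_gauge x.
Proof.
move=> h; apply: lb_le_inf => [|_ [s xs <-]]; last exact: h.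
by have [s xs] := dominating_nonempty x; exists (cost s), s.
Qed.

Lemma free_gauge_ge0 x : 0 <= free_gauge x.
Proof. by apply: free_gauge_ge => s _; exact: cost_ge0. Qed.

Lemma free_gaugeZ_le a x : free_gauge (a *: x) <= `|a| `^ p * free_gauge x.
Proof.
have [->|a0] := eqVneq a 0.
  rewrite normr0 powR0 ?gt_eqF// mul0r scale0r.
  apply: le_trans (free_gauge_le (s := [::]) _) _.
    by rewrite /dominating /= big_nil vabs0.
  by rewrite /cost big_nil.
have ap : 0 < `|a| `^ p by rewrite powR_gt0// normr_gt0.
rewrite mulrC -ler_pdivrMr//; apply: free_gauge_ge => s xs.
by rewrite ler_pdivrMr// mulrC -cost_scale; exact/free_gauge_le/dominatingZ.
Qed.

Lemma free_gauge_lattice_gauge : lattice_gauge p free_gauge.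
Proof.
split.
- move=> x y; rewrite -lerBlDr; apply: free_gauge_ge => s xs.
  rewrite lerBlDr -lerBlDl; apply: free_gauge_ge => t yt.
  rewrite lerBlDl -cost_cat; apply: free_gauge_le.
  exact: dominating_cat (vabsD x y) xs yt.
- move=> a x; apply/le_anti; rewrite free_gaugeZ_le /=.
  have [->|a0] := eqVneq a 0.
    by rewrite normr0 powR0 ?gt_eqF// mul0r free_gauge_ge0.
  have := free_gaugeZ_le a^-1 (a *: x); rewrite scalerA mulVf// scale1r => h.
  apply: le_trans (ler_wpM2l (powR_ge0 `|a| p) h) _.
  by rewrite mulrA -powRM// -normrM divff// normr1 powR1 mul1r.
- move=> x y xy; apply: free_gauge_ge => s ys; apply: free_gauge_le.
  exact: le_trans xy ys.
Qed.

(** The lower bound comes from interpreting a domination of [fgen e] in the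
    vector lattice of scalars, along all linear functionals. *)
Lemma free_gauge_gen e : free_gauge (fgen e) = pnorm e `^ p.
Proof.
apply/le_anti/andP; split.
  rewrite (_ : _ `^ p = cost [:: e]); last by rewrite /cost big_seq1.
  by apply: free_gauge_le; rewrite /dominating /= big_seq1.
apply: free_gauge_ge => s es; apply: pnorm_le_domination => // phi.
have := feval_le phi es; rewrite feval_vabs feval_gen linear_sum /=.
under eq_bigr do rewrite feval_vabs feval_gen vabs_normr.
by rewrite vabs_normr.
Qed.

(** Dominations are preserved by [feval T], and the [p]-th power of the norm
    of [X] turns them into inequalities between costs. *)
Lemma feval_bound (X : pbanachLatticeType p) (T : {linear E -> X}) (k : R) :
  0 <= k -> (forall e, pnorm (T e) <= k * pnorm e) ->
  forall x, pnorm (feval T x) `^ p <= k `^ p * free_gauge x.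
Proof.
move=> k0 Tk x; have QX := pnorm_gauge X hp.
have bound s : dominating x s -> pnorm (feval T x) `^ p <= k `^ p * cost s.
  move=> xs; have := feval_le T xs; rewrite feval_vabs linear_sum /=.
  under eq_bigr do rewrite feval_vabs feval_gen.
  move=> xT; apply: (@le_trans _ _ (pnorm (\sum_(e <- s) vabs (T e)) `^ p)).
    by apply: (gauge_le QX); rewrite [leRHS]vabs_id ?vsum_abs_ge0.
  apply: le_trans (gauge_sum hp QX _ _) _; rewrite /cost mulr_sumr.
  apply: ler_sum => e _; rewrite (gauge_abs QX) -powRM ?pnorm_ge0//.
  by rewrite ler_powRr ?mulr_ge0 ?pnorm_ge0.
have := powR_ge0 k p; rewrite le0r => /orP[/eqP kp|kp].
  have [s xs] := dominating_nonempty x.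
  by have := bound s xs; rewrite kp !mul0r.
rewrite mulrC -ler_pdivrMr//; apply: free_gauge_ge => s xs.
by rewrite ler_pdivrMr// mulrC; exact: bound.
Qed.

End FreeGauge.

(** * The free p-Banach lattice *)

Theorem theorem3p2 (R : realType) (p : R) (hp : 0 < p <= 1)
    (E : pbanachType p) :
  exists (FpBL : pbanachLatticeType p) (delta : {linear E -> FpBL}),
    (forall e : E, pnorm (delta e) = pnorm e) /\
    forall (X : pbanachLatticeType p) (T : {linear E -> X}), continuous T ->
      exists That : {linear FpBL -> X},
        [/\ lattice_homomorphism That,
            forall e : E, That (delta e) = T e,
            forall S : {linear FpBL -> X}, lattice_homomorphism S ->
              (forall e : E, S (delta e) = T e) ->
              forall f : FpBL, S f = That f
          & opnorm That = opnorm T].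
Proof.
have /andP[p0 _] := hp.
pose Q := @free_gauge R p E; pose hQ := free_gauge_lattice_gauge p0 E.
pose L : pbanachLatticeType p := completion p0 hQ.
pose emb : {linear free_vlat E -> L} := cembed p0 hQ.
pose delta : {linear E -> L} := (emb \o @fgen R E)%FUN.
have isom e : pnorm (delta e) = pnorm e.
  have gauge_delta : pnorm (delta e) `^ p = pnorm e `^ p.
    by rewrite [LHS](cpnormE (delta e)) [LHS]cgauge_cembed free_gauge_gen.
  by apply: (powR_injective p0) gauge_delta; rewrite nnegrE; exact: pnorm_ge0.
exists L, delta; split=> // X T Tc; have [k k0 Tk] := continuous_pbounded p0 Tc.
have T0 := opnorm_ge0 Tk; have Tn := pnorm_le_opnorm Tk.
have Tbound := feval_bound p0 T0 Tn.
have [That [ThatU Thatemb Thatbound]] := completion_extension p0 hQ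
  (feval_vjoin T) (powR_ge0 _ _) Tbound.
have Thatn x : pnorm (That x) <= opnorm T * pnorm x.
  rewrite -(ler_powRr p0 (pnorm_ge0 _) (mulr_ge0 T0 (pnorm_ge0 _))).
  by rewrite (powRM _ T0 (pnorm_ge0 _)) (cpnormE x).
have Thatc := pbounded_continuous p0 Thatn.
have Thatdelta e : That (delta e) = T e.
  by rewrite [LHS]Thatemb [LHS]feval_gen.
exists That; split => //.
- by split=> // x y; rewrite !vmeetE linearN ThatU !linearN.
- move=> S [Sc _ SU] Sdelta; apply: completion_map_unique => // x.
  rewrite Thatemb; elim/free_vlat_ind: x => [e|x y Sx Sy|a x Sx|x y Sx Sy].
  + by rewrite [RHS]feval_gen -Sdelta.
  + by rewrite !linearD /= Sx Sy.
  + by rewrite !linearZ /= Sx.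
  + by rewrite cembed_vjoin SU Sx Sy [RHS]feval_vjoin.
- apply/le_anti/andP; split; first exact: opnorm_le.
  apply: opnorm_le => [|e]; first exact: opnorm_ge0 Thatn.
  rewrite -Thatdelta -isom; exact: pnorm_le_opnorm Thatn _.
Qed.
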